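(* Let $A$ be a Minkowski Dedekind domain and $n$ a positive integer. For an ideal $I$ of $A$ the following are equivalent: (1) $I$ is $n$-congruing; (2) for every maximal ideal $\mathfrak p$ of $A$, the ideal $\hat I_{\mathfrak p}=I\hat A_{\mathfrak p}$ of $\hat A_{\mathfrak p}$ is $n$-congruing; (3) $\ker pr_n\subseteq I$. Consequently $\ker pr_n$ is the unique minimal $n$-congruing ideal of $A$.
   Context: An ideal $I$ of a commutative ring $A$ is $n$-congruing if for every $a\in A$ there is $N\in\mathbb{N}$ with $a^N(a^n-1)\in I$. A Dedekind domain $A$ is Minkowski if all residue fields $A/\mathfrak p$ are finite and for each $N$ only finitely many maximal ideals $\mathfrak p$ have $\#(A/\mathfrak p)<N$. For a maximal ideal $\mathfrak p$, $H^{\mathfrak p}_n$ is the ideal of the completion $\hat A_{\mathfrak p}$ generated by all $x^n-1$ with $x\in\hat A_{\mathfrak p}^\times$, and $pr_n:A\to\prod_{\mathfrak p}\hat A_{\mathfrak p}/H^{\mathfrak p}_n$ (product over all maximal ideals) is the ring homomorphism whose $\mathfrak p$-component is completion followed by reduction modulo $H^{\mathfrak p}_n$. *)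

(* Defs.v *)
From HB Require Import structures.
From mathcomp Require Import all_boot all_order all_algebra.
Set Implicit Arguments. Unset Strict Implicit. Unset Printing Implicit Defensive.
Import Order.TTheory GRing.Theory Num.Theory.
Local Open Scope ring_scope.

Section Defs.
Variable A : idomainType.

Definition ideal (I : A -> Prop) : Prop :=
  I 0 /\ (forall x y, I x -> I y -> I (x + y)) /\ (forall r x, I x -> I (r * x)).

Definition prime_ideal (P : A -> Prop) : Prop :=
  ideal P /\ ~ P 1 /\ (forall a b, P (a * b) -> P a \/ P b).

Definition maximal_ideal (M : A -> Prop) : Prop :=
  ideal M /\ ~ M 1 /\
  (forall J, ideal J -> (forall x, M x -> J x) -> J 1 \/ (forall x, J x -> M x)).

Definition noetherian : Prop :=
  forall I, ideal I -> exists (m : nat) (g : nat -> A),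
    (forall i, (i < m)%N -> I (g i)) /\
    (forall x, I x -> exists r : nat -> A, x = \sum_(i < m) r i * g i).

Definition integrally_closed : Prop :=
  forall z : {fraction A},
    (exists q : {poly A}, q \is monic /\ (map_poly (@FracField.tofrac A) q).[z] = 0) ->
    exists a : A, z = FracField.tofrac a.

Definition dedekind : Prop :=
  noetherian /\ integrally_closed /\
  (forall P, prime_ideal P -> (exists x, P x /\ x != 0) -> maximal_ideal P).

Definition residue_card_lt (p : A -> Prop) (N : nat) : Prop :=
  exists s : seq A, (size s < N)%N /\ forall a, exists2 b, b \in s & p (a - b).

Definition residue_finite (p : A -> Prop) : Prop :=
  exists N, residue_card_lt p N.

Definition minkowski : Prop :=
  (forall p, maximal_ideal p -> residue_finite p) /\
  (forall N, exists (m : nat) (P : nat -> A -> Prop),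
     forall p, maximal_ideal p -> residue_card_lt p N ->
       exists i, (i < m)%N /\ forall a, p a <-> P i a).

Definition congruing (n : nat) (I : A -> Prop) : Prop :=
  forall a : A, exists N : nat, I (a ^+ N * (a ^+ n - 1)).

Fixpoint ideal_pow (p : A -> Prop) (k : nat) : A -> Prop :=
  match k with
  | 0 => fun _ => True
  | k'.+1 => fun x => exists (m : nat) (u v : nat -> A),
      (forall i, (i < m)%N -> ideal_pow p k' (u i) /\ p (v i)) /\
      x = \sum_(i < m) u i * v i
  end.

(* Completion  \hat A_p = lim_k A/p^k : elements are coherent sequences
   (x_k)_k with x_(k+1) = x_k mod p^k, identified when x_k = y_k mod p^k
   for all k.  Ring operations are pointwise. *)
Definition compl_elt (p : A -> Prop) (x : nat -> A) : Prop :=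
  forall k, ideal_pow p k (x k.+1 - x k).

Definition compl_eq (p : A -> Prop) (x y : nat -> A) : Prop :=
  forall k, ideal_pow p k (x k - y k).

Definition cconst (a : A) : nat -> A := fun _ => a.

Definition compl_gen (p : A -> Prop) (S : (nat -> A) -> Prop) (x : nat -> A) : Prop :=
  compl_elt p x /\
  exists (m : nat) (r g : nat -> nat -> A),
    (forall i, (i < m)%N -> compl_elt p (r i) /\ compl_elt p (g i) /\ S (g i)) /\
    compl_eq p x (fun k => \sum_(i < m) r i k * g i k).

Definition compl_unit (p : A -> Prop) (x : nat -> A) : Prop :=
  compl_elt p x /\
  exists y, compl_elt p y /\ compl_eq p (fun k => x k * y k) (cconst 1).

Definition compl_ext (p : A -> Prop) (I : A -> Prop) : (nat -> A) -> Prop :=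
  compl_gen p (fun g => exists a, I a /\ compl_eq p g (cconst a)).

Definition Hn (p : A -> Prop) (n : nat) : (nat -> A) -> Prop :=
  compl_gen p (fun g => exists x, compl_unit p x /\
                         compl_eq p g (fun k => x k ^+ n - 1)).

Definition compl_congruing (p : A -> Prop) (n : nat) (J : (nat -> A) -> Prop) : Prop :=
  forall x, compl_elt p x ->
    exists N : nat, J (fun k => x k ^+ N * (x k ^+ n - 1)).

Definition ker_pr (n : nat) (a : A) : Prop :=
  forall p, maximal_ideal p -> Hn p n (cconst a).

End Defs.

(* Main.v *)
Require Import Defs.
From HB Require Import structures.
From mathcomp Require Import all_boot all_order all_algebra ring zify.
From Stdlib Require Import Classical ClassicalEpsilon FunctionalExtensionality PropExtensionality.
Set Implicit Arguments.
Unset Strict Implicit.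
Unset Printing Implicit Defensive.
Import GRing.Theory.
Local Open Scope ring_scope.

(** Write H_p for the ideal H^p_n of the completion at p.  An n-congruing ideal
    of the completion contains x^n - 1 for every unit x, because x^N is
    invertible; hence it contains H_p, and an ideal I of A all of whose
    completions are n-congruing contains ker pr_n by a local-global argument.
    Conversely ker pr_n is itself n-congruing.  If the residue field at p has
    more than n + 1 elements, some nonzero residue is not a root of X^n - 1, so
    H_p is everything; this leaves finitely many p.  There, x^n - 1 is in H_p
    when x is not in p, while H_p contains a power of p, so x^N is in H_p when x
    is in p.
    The only structural input on A is that, up to a factor outside p, a nonzero
    ideal contains a power of p ([ideal_pow_local]); this replaces unique
    factorisation and gives Krull's intersection theorem at once. *)


(** * Concatenation of finite families *)

Definition catf (T : Type) (m : nat) (f g : nat -> T) (i : nat) : T :=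
  if (i < m)%N then f i else g (i - m)%N.

Lemma catfP (T : Type) (P : T -> Prop) (m1 m2 : nat) (f g : nat -> T) :
  (forall i, (i < m1)%N -> P (f i)) -> (forall i, (i < m2)%N -> P (g i)) ->
  forall i, (i < m1 + m2)%N -> P (catf m1 f g i).
Proof.
move=> Pf Pg i lti; rewrite /catf; case: ltnP => [|le_mi]; first exact: Pf.
by apply: Pg; rewrite ltn_subLR.
Qed.

Lemma catf_pair (T U : Type) (m : nat) (f g : nat -> T) (f' g' : nat -> U) (i : nat) :
  catf m (fun i => (f i, f' i)) (fun i => (g i, g' i)) i = (catf m f g i, catf m f' g' i).
Proof. by rewrite /catf; case: ifP. Qed.

Lemma sum_catf (V : nmodType) (T U : Type) (F : T -> U -> V) (m1 m2 : nat)
    (f g : nat -> T) (f' g' : nat -> U) :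
  \sum_(i < m1 + m2) F (catf m1 f g i) (catf m1 f' g' i) =
  \sum_(i < m1) F (f i) (f' i) + \sum_(i < m2) F (g i) (g' i).
Proof.
rewrite big_split_ord /=; congr (_ + _); apply: eq_bigr => i _.
  by rewrite /catf ltn_ord.
by rewrite /catf ltnNge leq_addr /= addKn.
Qed.

(** * Ideals of a domain *)

Section Ideals.
Variable A : idomainType.
Implicit Types (I J p : A -> Prop) (a b s : A).

Section Closure.
Variable I : A -> Prop.
Hypothesis idI : ideal I.

Lemma ideal_zero : I 0. Proof. by case: idI. Qed.

Lemma ideal_add x y : I x -> I y -> I (x + y).
Proof. by case: idI => _ [+ _]; apply. Qed.

Lemma ideal_mull r x : I x -> I (r * x).
Proof. by case: idI => _ [_]; apply. Qed.

Lemma ideal_mulr r x : I x -> I (x * r).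
Proof. by rewrite mulrC; apply: ideal_mull. Qed.

Lemma ideal_opp x : I x -> I (- x).
Proof. by rewrite -mulN1r; apply: ideal_mull. Qed.

Lemma ideal_sub x y : I x -> I y -> I (x - y).
Proof. by move=> Ix Iy; apply: ideal_add => //; apply: ideal_opp. Qed.

Lemma ideal_sum (m : nat) (F : nat -> A) :
  (forall i, (i < m)%N -> I (F i)) -> I (\sum_(i < m) F i).
Proof.
move=> IF; apply: (big_ind I) => [|x y|i _]; [exact: ideal_zero|exact: ideal_add|].
exact: IF.
Qed.

End Closure.

Definition ideal_adjoin (I : A -> Prop) (a : A) : A -> Prop :=
  fun x => exists y r, I y /\ x = y + r * a.

Lemma ideal_adjoin_ideal I a : ideal I -> ideal (ideal_adjoin I a).
Proof.
move=> idI; split; [|split].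
- by exists 0, 0; split; [exact: ideal_zero|ring].
- move=> _ _ [x [r [Ix ->]]] [y [t [Iy ->]]].
  by exists (x + y), (r + t); split; [exact: ideal_add|ring].
- move=> t _ [x [r [Ix ->]]].
  by exists (t * x), (t * r); split; [exact: ideal_mull|ring].
Qed.

Lemma ideal_adjoin_sub I a x : I x -> ideal_adjoin I a x.
Proof. by exists x, 0; split=> //; ring. Qed.

Lemma ideal_adjoin_mem I a : ideal I -> ideal_adjoin I a a.
Proof. by move=> idI; exists 0, 1; split; [exact: ideal_zero|ring]. Qed.

Lemma principal_ideal a : ideal (fun x => exists r, x = r * a).
Proof.
split; [|split].
- by exists 0; rewrite mul0r.
- by move=> _ _ [r ->] [t ->]; exists (r + t); rewrite mulrDl.
- by move=> t _ [r ->]; exists (t * r); rewrite mulrA.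
Qed.

(** * Maximal ideals *)

Section Maximal.
Variable p : A -> Prop.
Hypothesis maxp : maximal_ideal p.

Lemma maximal_ideal_ideal : ideal p. Proof. by case: maxp. Qed.

Lemma maximal_ideal_proper : ~ p 1. Proof. by case: maxp => _ []. Qed.

(** Maximality is applied to [p + (s)], which is not contained in [p] and therefore contains 1. *)
Lemma maximal_ideal_inv s : ~ p s -> exists t, p (s * t - 1).
Proof.
move=> nps; case: maxp => idp [_ /(_ (ideal_adjoin p s))].
case; [exact: ideal_adjoin_ideal|exact: ideal_adjoin_sub| |].
  move=> [x [r [px e]]]; exists r; rewrite e.
  by rewrite (_ : _ - _ = - x); [exact: ideal_opp|ring].
by move/(_ s (ideal_adjoin_mem s idp)).
Qed.

Lemma maximal_ideal_prime a b : p (a * b) -> p a \/ p b.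
Proof.
have idp := maximal_ideal_ideal.
move=> pab; case: (classic (p a)) => [|npa]; [by left|right].
have [t pt] := maximal_ideal_inv npa.
rewrite (_ : b = t * (a * b) - b * (a * t - 1)); last by ring.
by apply: ideal_sub => //; apply: ideal_mull.
Qed.

Lemma maximal_ideal_nmul a b : ~ p a -> ~ p b -> ~ p (a * b).
Proof. by move=> npa npb /maximal_ideal_prime []. Qed.

End Maximal.

(** A counterexample would start a strictly increasing chain of counterexamples. The union of the
    chain is finitely generated, so all its generators lie in one term [C K], and the chain could
    not grow after it. *)
Lemma noetherian_ind (Q : (A -> Prop) -> Prop) : noetherian A ->
  (forall I, ideal I ->
     (forall J, ideal J -> (forall x, I x -> J x) -> (exists x, J x /\ ~ I x) -> Q J) ->
     Q I) ->
  forall I, ideal I -> Q I.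
Proof.
move=> noeth step I0 idI0; apply: NNPP => nQ0.
pose T := {I : A -> Prop | ideal I /\ ~ Q I}.
(* Dependent choice: without a strictly larger counterexample, [step] would prove [Q] for this
   ideal. *)
have next (I : T) : {J : T | (forall x, sval I x -> sval J x) /\
                             exists x, sval J x /\ ~ sval I x}.
  apply: constructive_indefinite_description.
  case: I => I [idI nQ] /=; apply: NNPP => noJ; apply: nQ.
  apply: step => // J idJ IJ ltIJ; apply: NNPP => nQJ; apply: noJ.
  by exists (exist _ J (conj idJ nQJ)).
pose C := fix C k : T := if k is k'.+1 then sval (next (C k')) else exist _ I0 (conj idI0 nQ0).
have CS k x : sval (C k) x -> sval (C k.+1) x.
  by rewrite /=; case: (next _) => J /= [+ _]; apply.
have Cle j k x : (j <= k)%N -> sval (C j) x -> sval (C k) x.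
  elim: k => [|k IHk]; first by rewrite leqn0 => /eqP ->.
  rewrite leq_eqVlt => /orP[/eqP -> //|ltjk] Cx.
  by apply: CS; apply: IHk.
have idC k : ideal (sval (C k)) by case: (svalP (C k)).
pose U x := exists k, sval (C k) x.
have idU : ideal U.
  split; [|split].
  - by exists 0%N; apply: ideal_zero.
  - move=> x y [j Cx] [k Cy]; exists (maxn j k).
    by apply: ideal_add => //; [apply: Cle Cx|apply: Cle Cy]; rewrite ?leq_maxl ?leq_maxr.
  - by move=> r x [k Cx]; exists k; apply: ideal_mull.
have [m [g [Ug genU]]] := noeth U idU.
have [K CK] : exists K, forall i, (i < m)%N -> sval (C K) (g i).
  elim: m Ug {genU} => [|m IHm] Ug; first by exists 0%N.
  have [i lti|K CK] := IHm; first by apply: Ug; apply: ltnW.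
  have [k Ck] := Ug m (leqnn _).
  exists (maxn K k) => i; rewrite ltnS leq_eqVlt => /orP[/eqP ->|lti].
    by apply: Cle Ck; rewrite leq_maxr.
  by apply: Cle (CK i lti); rewrite leq_maxl.
have [_ [x [Cx nCx]]] := svalP (next (C K)).
have [r ex] := genU x (ex_intro _ K.+1 Cx); apply: nCx; rewrite ex.
apply: (@ideal_sum _ (idC K) m (fun i => r i * g i)) => i lti.
by apply: ideal_mull => //; apply: CK.
Qed.

(** Noetherian induction takes the place of Zorn's lemma: a proper ideal that is not maximal sits
    strictly inside a larger proper one. *)
Lemma exists_maximal_ideal I : noetherian A -> ideal I -> ~ I 1 ->
  exists p, maximal_ideal p /\ forall x, I x -> p x.
Proof.
move=> noeth; move: I; refine (noetherian_ind noeth _) => I idI IH nI1.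
case: (classic (maximal_ideal I)) => [maxI|nmaxI]; first by exists I.
apply: NNPP => nex; apply: nmaxI; split=> //; split=> // J idJ IJ.
case: (classic (J 1)) => [|nJ1]; [by left|right=> x Jx].
apply: NNPP => nIx; apply: nex.
have [|p [maxp Jp]] := IH J idJ IJ _ nJ1; first by exists x.
by exists p; split=> // y /IJ /Jp.
Qed.

(** The ideal of all [x] with [x * a] in [I] lies in no maximal ideal, hence contains 1. *)
Lemma ideal_local I a : noetherian A -> ideal I ->
  (forall p, maximal_ideal p -> exists2 s, ~ p s & I (s * a)) -> I a.
Proof.
move=> noeth idI loc; apply: NNPP => nIa.
have idIa : ideal (fun x => I (x * a)).
  split; [|split].
  - by rewrite mul0r; exact: ideal_zero.
  - by move=> x y Ix Iy; rewrite mulrDl; exact: ideal_add.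
  - by move=> r x Ix; rewrite -mulrA; exact: ideal_mull.
have [|p [maxp Ip]] := exists_maximal_ideal noeth idIa; first by rewrite mul1r.
by have [s nps /Ip] := loc p maxp.
Qed.

(** * Powers of an ideal *)

Section Powers.
Variable p : A -> Prop.

Lemma ideal_powS_ind k (Q : A -> Prop) : Q 0 ->
  (forall x y, Q x -> Q y -> Q (x + y)) ->
  (forall u v, ideal_pow p k u -> p v -> Q (u * v)) ->
  forall x, ideal_pow p k.+1 x -> Q x.
Proof.
move=> Q0 QD QM x [m [u [v [uv ->]]]].
by apply: big_ind => // i _; have [] := uv i (ltn_ord i); apply: QM.
Qed.

Lemma ideal_powS_mul k u v : ideal_pow p k u -> p v -> ideal_pow p k.+1 (u * v).
Proof.
by move=> pu pv; exists 1%N, (fun=> u), (fun=> v); split=> //; rewrite big_ord1.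
Qed.

Lemma ideal_pow_ideal k : ideal (ideal_pow p k).
Proof.
elim: k => [|k IHk]; first by [].
have add x y : ideal_pow p k.+1 x -> ideal_pow p k.+1 y -> ideal_pow p k.+1 (x + y).
  move=> [m [u [v [uv ->]]]] [m' [u' [v' [uv' ->]]]].
  exists (m + m')%N, (catf m u u'), (catf m v v'); split.
    (* Pairing the two families lets [catfP] treat both factors at once. *)
    move=> i lti; have := catfP (P := fun w => ideal_pow p k w.1 /\ p w.2)
      (f := fun i => (u i, v i)) (g := fun i => (u' i, v' i)) uv uv' lti.
    by rewrite catf_pair.
  by rewrite (sum_catf (fun a b => a * b)).
have zero : ideal_pow p k.+1 0.
  by exists 0%N, (fun=> 0), (fun=> 0); split=> //; rewrite big_ord0.
split=> //; split=> // r; apply: ideal_powS_ind => [|y z|u v pu pv].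
- by rewrite mulr0.
- by rewrite mulrDr; apply: add.
- by rewrite mulrA; apply: ideal_powS_mul => //; apply: ideal_mull.
Qed.

Lemma ideal_powS_sub k x : ideal_pow p k.+1 x -> ideal_pow p k x.
Proof.
have idpk := ideal_pow_ideal k.
move: x; apply: ideal_powS_ind => [|x y|u v pu _].
- exact: ideal_zero.
- exact: ideal_add.
- exact: ideal_mulr.
Qed.

Lemma ideal_pow_sub j k x : (j <= k)%N -> ideal_pow p k x -> ideal_pow p j x.
Proof.
elim: k => [|k IHk]; first by rewrite leqn0 => /eqP ->.
rewrite leq_eqVlt => /orP[/eqP -> //|ltjk] /ideal_powS_sub; exact: IHk.
Qed.

Lemma ideal_powX k x : p x -> ideal_pow p k (x ^+ k).
Proof. by move=> px; elim: k => // k IHk; rewrite exprSr; apply: ideal_powS_mul. Qed.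

(** By induction on [j], each further factor from [p] is absorbed into the coefficients, so the
    generators [g] stay fixed. The coefficients in [p^j] later serve as increments of convergent
    series. *)
Lemma ideal_pow_add_gen K m (g : nat -> A) :
  (forall x, ideal_pow p K x -> exists r : nat -> A, x = \sum_(i < m) r i * g i) ->
  forall j x, ideal_pow p (j + K) x ->
  exists c : nat -> A, (forall i, ideal_pow p j (c i)) /\ x = \sum_(i < m) c i * g i.
Proof.
move=> gen; elim=> [|j IHj] x; first by move/gen=> [r ->]; exists r.
have idpj := ideal_pow_ideal j.+1.
rewrite addSn; move: x; apply: ideal_powS_ind => [|x y|u v].
- exists (fun=> 0); split=> [i|]; first exact: ideal_zero.
  by rewrite big1 // => i _; rewrite mul0r.
- move=> [c [pc ->]] [d [pd ->]]; exists (fun i => c i + d i).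
  split=> [i|]; first exact: ideal_add.
  by rewrite -big_split; apply: eq_bigr => i _; rewrite mulrDl.
- move=> /IHj [c [pc ->]] pv; exists (fun i => c i * v).
  split=> [i|]; first exact: ideal_powS_mul.
  by rewrite mulr_suml; apply: eq_bigr => i _; rewrite mulrAC.
Qed.

Lemma ideal_pow_add_sub J j K s : noetherian A -> ideal J ->
  (forall x y, ideal_pow p j x -> ideal_pow p K y -> J (s * (x * y))) ->
  forall z, ideal_pow p (j + K) z -> J (s * z).
Proof.
move=> noeth idJ Jxy z.
have [m [g [pg gen]]] := noeth _ (ideal_pow_ideal K).
move=> /(ideal_pow_add_gen gen) [c [pc ->]]; rewrite mulr_sumr.
apply: (@ideal_sum _ idJ m (fun i => s * (c i * g i))) => i lti.
by apply: Jxy => //; apply: pg.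
Qed.

End Powers.

(** Noetherian induction. A nonzero prime [I] is maximal: either it equals [p] and [k = 1] works, or
    it has an element [s] outside [p] and [k = 0] works. If [I] is proper and not prime, some
    [a * b] lies in [I] with [a] and [b] outside, and the results for [I + (a)] and [I + (b)] are
    combined. *)
Lemma ideal_pow_local p I : dedekind A -> maximal_ideal p -> ideal I ->
  (exists x, I x /\ x != 0) ->
  exists k s, ~ p s /\ forall x, ideal_pow p k x -> I (s * x).
Proof.
move=> [noeth [_ dim1]] maxp; have idp := maximal_ideal_ideal maxp.
move: I; refine (noetherian_ind noeth _) => I idI IH [z [Iz z0]].
case: (classic (I 1)) => [I1|nI1].
  exists 0%N, 1; split; first exact: maximal_ideal_proper.
  by move=> x _; rewrite mul1r -[x]mulr1; apply: ideal_mull.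
case: (classic (prime_ideal I)) => [primeI|nprimeI].
  have [_ [_ maxI]] := dim1 I primeI (ex_intro _ z (conj Iz z0)).
  case: (classic (forall x, I x -> p x)) => [Ip|nIp].
    exists 1%N, 1; split; first exact: maximal_ideal_proper.
    move=> x px; rewrite mul1r; case: (maxI p idp Ip) => [/(maximal_ideal_proper maxp)//|].
    by apply; move: x px; apply: ideal_powS_ind; [exact: ideal_zero|exact: ideal_add|
       move=> u v _; exact: ideal_mull].
  have [s [Is nps]] : exists s, I s /\ ~ p s.
    apply: NNPP => nex; apply: nIp => x Ix; apply: NNPP => npx; apply: nex.
    by exists x.
  by exists 0%N, s; split=> // x _; apply: ideal_mulr.
have [a [b [Iab [nIa nIb]]]] : exists a b, I (a * b) /\ ~ I a /\ ~ I b.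
  apply: NNPP => nex; apply: nprimeI; split=> //; split=> // a b Iab.
  apply: NNPP => /not_or_and [nIa nIb]; apply: nex; by exists a, b.
have adj c : ~ I c -> exists k s, ~ p s /\ forall x, ideal_pow p k x -> ideal_adjoin I c (s * x).
  move=> nIc; apply: IH; [exact: ideal_adjoin_ideal|exact: ideal_adjoin_sub| |].
    by exists c; split=> //; exact: ideal_adjoin_mem.
  by exists z; split=> //; apply: ideal_adjoin_sub.
have [j [s [nps Hs]]] := adj a nIa; have [k [t [npt Ht]]] := adj b nIb.
exists (j + k)%N, (s * t); split; first exact: maximal_ideal_nmul.
(* The product of [I + (a)] and [I + (b)] lies in [I], so the exponents add and the outside factors
   multiply. *)
refine (ideal_pow_add_sub noeth idI _) => x y /Hs [u [r [Iu e]]] /Ht [v [q [Iv f]]].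
rewrite (_ : _ * _ = (s * x) * (t * y)); last by ring.
rewrite e f (_ : _ * _ = (v + q * b) * u + (r * a) * v + (r * q) * (a * b)); last by ring.
by apply: ideal_add => //; [apply: ideal_add|] => //; apply: ideal_mull.
Qed.

Lemma ideal_pow_cap0 p a : dedekind A -> maximal_ideal p ->
  (forall k, ideal_pow p k a) -> a = 0.
Proof.
move=> dedA maxp pa; have idp := maximal_ideal_ideal maxp.
apply/eqP; apply/negPn/negP => a0.
(* If a <> 0, then s a lies in (a^2) for some s outside p, so s lies in (a). *)
have [|k [s [nps Hs]]] := ideal_pow_local dedA maxp (principal_ideal (a ^+ 2)).
  by exists (a ^+ 2); split; [exists 1; rewrite mul1r|rewrite expf_neq0].
have [r e] := Hs a (pa k); apply: nps.
have -> : s = r * a by apply: (mulIf a0); rewrite e; ring.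
apply: ideal_mull => //; have := pa 1%N; move: a {pa a0 Hs e}.
by apply: ideal_powS_ind; [exact: ideal_zero|exact: ideal_add|move=> u v _; exact: ideal_mull].
Qed.

End Ideals.

(** * The completion as a ring of coherent sequences *)

Section Completion.
Variables (A : idomainType) (p : A -> Prop).
Implicit Types (x y z r g : nat -> A) (S T : (nat -> A) -> Prop) (a b s : A).

Local Notation idpk := (ideal_pow_ideal p).

Lemma compl_eq_refl x : compl_eq p x x.
Proof. by move=> k; rewrite subrr; apply: ideal_zero (idpk k). Qed.

Lemma compl_eq_trans y x z : compl_eq p x y -> compl_eq p y z -> compl_eq p x z.
Proof.
move=> xy yz k; rewrite (_ : _ - _ = (x k - y k) + (y k - z k)); last by ring.
by apply: (ideal_add (idpk k)).
Qed.

Lemma compl_eqD x y x' y' : compl_eq p x x' -> compl_eq p y y' ->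
  compl_eq p (fun k => x k + y k) (fun k => x' k + y' k).
Proof.
move=> xx yy k; rewrite (_ : _ - _ = (x k - x' k) + (y k - y' k)); last by ring.
by apply: (ideal_add (idpk k)).
Qed.

Lemma compl_eqM x y x' y' : compl_eq p x x' -> compl_eq p y y' ->
  compl_eq p (fun k => x k * y k) (fun k => x' k * y' k).
Proof.
move=> xx yy k; have idk := idpk k.
rewrite (_ : _ - _ = x k * (y k - y' k) + y' k * (x k - x' k)); last by ring.
by apply: ideal_add => //; apply: ideal_mull.
Qed.

Lemma compl_elt_const a : compl_elt p (cconst a).
Proof. by move=> k; rewrite subrr; apply: ideal_zero (idpk k). Qed.

Lemma compl_eltD x y : compl_elt p x -> compl_elt p y -> compl_elt p (fun k => x k + y k).
Proof.
move=> xE yE k; rewrite (_ : _ - _ = (x k.+1 - x k) + (y k.+1 - y k)); last by ring.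
by apply: (ideal_add (idpk k)).
Qed.

Lemma compl_eltM x y : compl_elt p x -> compl_elt p y -> compl_elt p (fun k => x k * y k).
Proof.
move=> xE yE k; have idk := idpk k.
rewrite (_ : _ - _ = x k.+1 * (y k.+1 - y k) + y k * (x k.+1 - x k)); last by ring.
by apply: ideal_add => //; apply: ideal_mull.
Qed.

Lemma compl_eltB x y : compl_elt p x -> compl_elt p y -> compl_elt p (fun k => x k - y k).
Proof.
move=> xE yE k; rewrite (_ : _ - _ = (x k.+1 - x k) - (y k.+1 - y k)); last by ring.
by apply: (ideal_sub (idpk k)).
Qed.

Lemma compl_eltX x n : compl_elt p x -> compl_elt p (fun k => x k ^+ n).
Proof.
move=> xE; elim: n => [|n IHn] k; first by rewrite subrr; apply: ideal_zero (idpk k).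
by rewrite !exprS; exact: (compl_eltM xE IHn).
Qed.

Lemma compl_elt_le x j k : compl_elt p x -> (j <= k)%N -> ideal_pow p j (x k - x j).
Proof.
move=> xE /subnK <-; have idj := idpk j.
elim: (k - j)%N => [|m IHm]; first by rewrite subrr; apply: ideal_zero.
rewrite (_ : _ - _ = (x (m.+1 + j)%N - x (m + j)%N) + (x (m + j)%N - x j)); last by ring.
apply: ideal_add => //; apply: (ideal_pow_sub (leq_addl m j)); exact: xE.
Qed.

(** * Ideals of the completion given by generators *)

Section Generated.
Variable S : (nat -> A) -> Prop.

Lemma compl_gen_eq y x : compl_elt p x -> compl_eq p x y -> compl_gen p S y ->
  compl_gen p S x.
Proof.
move=> xE xy [_ [m [r [g [rg e]]]]]; split=> //.
by exists m, r, g; split=> //; apply: compl_eq_trans xy e.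
Qed.

Lemma compl_gen0 : compl_gen p S (cconst 0).
Proof.
split; first exact: compl_elt_const.
exists 0%N, (fun _ _ => 0), (fun _ _ => 0); split=> // k.
by rewrite big_ord0 subrr; apply: ideal_zero (idpk k).
Qed.

Lemma compl_genD x y : compl_gen p S x -> compl_gen p S y ->
  compl_gen p S (fun k => x k + y k).
Proof.
move=> [xE [m [r [g [rg e]]]]] [yE [m' [r' [g' [rg' e']]]]].
split; first exact: compl_eltD.
exists (m + m')%N, (catf m r r'), (catf m g g'); split.
  move=> i lti.
  have := catfP (P := fun w => compl_elt p w.1 /\ compl_elt p w.2 /\ S w.2)
    (f := fun i => (r i, g i)) (g := fun i => (r' i, g' i)) rg rg' lti.
  by rewrite catf_pair.
move=> k; rewrite (sum_catf (fun u v : nat -> A => u k * v k)).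
exact: (compl_eqD e e').
Qed.

Lemma compl_genM r x : compl_elt p r -> compl_gen p S x ->
  compl_gen p S (fun k => r k * x k).
Proof.
move=> rE [xE [m [u [g [ug e]]]]]; split; first exact: compl_eltM.
exists m, (fun i k => r k * u i k), g; split=> [i /ug [uE gS]|].
  by split=> //; apply: compl_eltM.
move=> k; under eq_bigr do rewrite -mulrA; rewrite -mulr_sumr.
exact: (compl_eqM (compl_eq_refl r) e).
Qed.

Lemma compl_gen_sum m (F : nat -> nat -> A) :
  (forall i, (i < m)%N -> compl_gen p S (F i)) ->
  compl_gen p S (fun k => \sum_(i < m) F i k).
Proof.
elim: m => [|m IHm] HF.
  rewrite (_ : (fun _ => _) = cconst 0); first exact: compl_gen0.
  by apply: functional_extensionality => k; rewrite big_ord0.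
rewrite (_ : (fun _ => _) = (fun k => \sum_(i < m) F i k + F m k)); last first.
  by apply: functional_extensionality => k; rewrite big_ord_recr.
apply: compl_genD; last exact: HF.
by apply: IHm => i lti; apply: HF; apply: ltnW.
Qed.

Lemma compl_gen_mem g : compl_elt p g -> S g -> compl_gen p S g.
Proof.
move=> gE Sg; split=> //; exists 1%N, (fun _ => cconst 1), (fun _ => g); split.
  by move=> _ _; split=> //; apply: compl_elt_const.
by move=> k; rewrite big_ord1 mul1r; apply: compl_eq_refl.
Qed.

(** This contraction to [A] turns membership of constants in [H_p] into ideal arithmetic in [A]. *)
Lemma compl_gen_const_ideal : ideal (fun a => compl_gen p S (cconst a)).
Proof.
split; [|split].
- exact: compl_gen0.
- by move=> a b; apply: compl_genD.
- by move=> r a; apply: compl_genM; apply: compl_elt_const.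
Qed.

End Generated.

Lemma compl_gen_sub S T x :
  (forall g, compl_elt p g -> S g -> compl_gen p T g) ->
  compl_gen p S x -> compl_gen p T x.
Proof.
move=> ST [xE [m [r [g [rg e]]]]]; apply: (compl_gen_eq xE e).
apply: (@compl_gen_sum T m (fun i k => r i k * g i k)) => i /rg [rE [gE Sg]].
by apply: compl_genM => //; apply: ST.
Qed.

Lemma compl_ext_mem (I : A -> Prop) a : I a -> compl_ext p I (cconst a).
Proof.
move=> Ia; apply: compl_gen_mem; first exact: compl_elt_const.
by exists a; split=> //; apply: compl_eq_refl.
Qed.

(** At level [k] the coefficients are elements of [A], and each generator agrees modulo [p^k] with
    an element of [I]. This brings membership in the extended ideal back to [A]. *)
Lemma compl_ext_approx (I : A -> Prop) x k : ideal I -> compl_ext p I x ->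
  exists2 b, I b & ideal_pow p k (x k - b).
Proof.
move=> idI [_ [m [r [g [rg e]]]]]; have idk := idpk k.
suff [b Ib pb] : exists2 b, I b & ideal_pow p k (\sum_(i < m) r i k * g i k - b).
  exists b => //; rewrite (_ : _ - _ = (x k - \sum_(i < m) r i k * g i k)
    + (\sum_(i < m) r i k * g i k - b)); last by ring.
  exact: ideal_add.
elim: m rg {e} => [|m IHm] rg.
  by exists 0; [exact: ideal_zero|rewrite big_ord0 subrr; exact: ideal_zero].
have [i lti|b Ib pb] := IHm; first by apply: rg; apply: ltnW.
have [_ [_ [a [Ia ga]]]] := rg m (leqnn _).
exists (b + r m k * a); first by apply: ideal_add => //; apply: ideal_mull.
rewrite big_ord_recr /=.
rewrite (_ : _ - _ = (\sum_(i < m) r i k * g i k - b) + r m k * (g m k - a)); last by ring.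
by apply: ideal_add => //; apply: ideal_mull => //; apply: ga.
Qed.

(** * The completion at a maximal ideal *)

Section Local.
Hypothesis maxp : maximal_ideal p.

(* The inverse of s is the geometric series of 1 - s t, where s t = 1 mod p. *)
Lemma compl_inv s : ~ p s -> exists t, compl_elt p t /\ compl_eq p (fun k => s * t k) (cconst 1).
Proof.
move=> /(maximal_ideal_inv maxp) [t pt].
have idp := maximal_ideal_ideal maxp.
have pe k : ideal_pow p k ((1 - s * t) ^+ k).
  by apply: ideal_powX; rewrite -opprB; apply: ideal_opp.
exists (fun k => t * \sum_(i < k) (1 - s * t) ^+ i); split=> k.
  rewrite big_ord_recr /= (_ : _ - _ = t * (1 - s * t) ^+ k); last by ring.
  by apply: (ideal_mull (idpk k)).
rewrite /cconst (_ : _ - _ = - (1 - s * t) ^+ k); first by apply: (ideal_opp (idpk k)).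
have := subrX1 (1 - s * t) k; move: (\sum_(i < k) _) => S /eqP; rewrite subr_eq => /eqP ->; ring.
Qed.

Lemma compl_unit_const s : ~ p s -> compl_unit p (cconst s).
Proof. by move=> /compl_inv [t Ht]; split; [apply: compl_elt_const|exists t]. Qed.

(** An element outside [p] is a unit of the completion, so it can be cancelled. *)
Lemma compl_gen_div S s a : ~ p s -> compl_gen p S (cconst (s * a)) ->
  compl_gen p S (cconst a).
Proof.
move=> /compl_inv [t [tE st]] Ssa.
apply: (compl_gen_eq (compl_elt_const a) _ (compl_genM tE Ssa)).
move=> k; rewrite /cconst (_ : _ - _ = (- a) * (s * t k - 1)); last by ring.
exact: (ideal_mull (idpk k) _ (st k)).
Qed.

(** With [g] generating [p^K], the start [y K] and all later increments of [y] are combinations of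
    the [g i]. The coefficients of the increments tend to 0, so their sums converge to coefficients
    [r i] expressing [y] through the [g i]. Each [g i] lies in the extension of [I] once [s] is
    cancelled. *)
Lemma compl_ext_small (I : A -> Prop) K s y : noetherian A -> ~ p s ->
  (forall a, ideal_pow p K a -> I (s * a)) ->
  compl_elt p y -> ideal_pow p K (y K) -> compl_ext p I y.
Proof.
move=> noeth nps sI yE yK.
have [m [g [pg gen]]] := noeth _ (idpk K).
have [e ye] := gen _ yK.
(* The increment at [k + K] lies in [p^(k + K)], so its coefficients can be taken in [p^k]. Choice
   makes them a function of [k]. *)
have coef k : {c : nat -> A | (forall i, ideal_pow p k (c i)) /\
    y (k + K).+1 - y (k + K)%N = \sum_(i < m) c i * g i}.
  apply: constructive_indefinite_description.
  by apply: (ideal_pow_add_gen gen); apply: yE.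
pose c k := sval (coef k).
have pc k (i : nat) : ideal_pow p k (c k i) := proj1 (svalP (coef k)) i.
have yc k : y (k + K).+1 - y (k + K)%N = \sum_(i < m) c k i * g i.
  exact: (proj2 (svalP (coef k))).
pose r (i k : nat) := e i + \sum_(j < k) c j i.
have rE i : compl_elt p (r i).
  by move=> k; rewrite /r big_ord_recr /= (_ : _ - _ = c k i) //; ring.
have yr k : y (k + K)%N = \sum_(i < m) r i k * g i.
  elim: k => [|k IHk].
    by rewrite add0n ye; apply: eq_bigr => i _; rewrite /r big_ord0 addr0.
  rewrite addSn -[LHS](subrK (y (k + K)%N)) yc IHk -big_split.
  by apply: eq_bigr => i _; rewrite /r big_ord_recr /=; ring.
(* By coherence, the shifted sequence [y (k + K)] represents the same element as [y]. *)
apply: (@compl_gen_eq _ (fun k => \sum_(i < m) r i k * g i)) => //.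
  move=> k; rewrite -yr -opprB; apply: (ideal_opp (idpk k)).
  by apply: compl_elt_le; rewrite // leq_addr.
apply: (@compl_gen_sum _ m (fun i k => r i k * g i)) => i lti.
apply: (compl_genM (rE i)); apply: (compl_gen_div nps).
by apply: compl_ext_mem; apply: sI; apply: pg.
Qed.

(** The hypothesis on [I] is used only at the component [x K]: the sequence [z] differs from the
    constant [z K] by an element vanishing at level [K], which [compl_ext_small] absorbs. *)
Lemma compl_ext_congruing (I : A -> Prop) n K s : noetherian A -> ideal I -> ~ p s ->
  (forall a, ideal_pow p K a -> I (s * a)) ->
  congruing n I -> compl_congruing p n (compl_ext p I).
Proof.
move=> noeth idI nps sI congI x xE; have [N IN] := congI (x K); exists N.
pose z k := x k ^+ N * (x k ^+ n - 1).
have zE : compl_elt p z.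
  apply: compl_eltM; first exact: compl_eltX.
  by apply: compl_eltB; [exact: compl_eltX|exact: compl_elt_const].
have zKE : compl_elt p (cconst (z K)) by exact: compl_elt_const.
apply: (@compl_gen_eq _ (fun k => (z k - cconst (z K) k) + cconst (z K) k)) => //.
  by move=> k; rewrite subrK; apply: compl_eq_refl.
apply: compl_genD; last exact: compl_ext_mem.
apply: (compl_ext_small noeth nps sI); first exact: compl_eltB.
by rewrite subrr; apply: ideal_zero (idpk K).
Qed.

Lemma Hn_const_ideal n : ideal (fun a => Hn p n (cconst a)).
Proof. exact: compl_gen_const_ideal. Qed.

Lemma Hn_mem n u : ~ p u -> Hn p n (cconst (u ^+ n - 1)).
Proof.
move=> npu; apply: compl_gen_mem; first exact: compl_elt_const.
by exists (cconst u); split; [exact: compl_unit_const|exact: compl_eq_refl].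
Qed.

Lemma Hn_sub_ext n (I : A -> Prop) x :
  compl_congruing p n (compl_ext p I) -> Hn p n x -> compl_ext p I x.
Proof.
move=> congI; apply: compl_gen_sub => g gE [u [[uE [v [vE uv]]] gu]].
have [N uN] := congI u uE.
have vu : compl_eq p (fun k => v k * u k) (cconst 1).
  by move=> k; rewrite mulrC; apply: uv.
(* Multiplying [u^N (u^n - 1)] by [v^N], with [v] the inverse of [u], recovers [u^n - 1]. *)
apply: (compl_gen_eq gE _ (compl_genM (compl_eltX N vE) uN)).
apply: compl_eq_trans gu _ => k; rewrite mulrA -exprMn.
have : compl_eq p (fun k => (v k * u k) ^+ N) (cconst 1).
  elim: N {uN} => [|N IHN] j; first by rewrite expr0; apply: compl_eq_refl.
  rewrite exprS /cconst -[1 in X in _ - X]mulr1.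
  exact: (compl_eqM vu IHN j).
move=> /(_ k) vu1.
rewrite (_ : _ - _ = (1 - u k ^+ n) * ((v k * u k) ^+ N - 1)); last by ring.
exact: (ideal_mull (idpk k) _ vu1).
Qed.

End Local.
End Completion.

(** * Counting residues modulo a maximal ideal *)

Section Residues.
Variables (A : idomainType) (p : A -> Prop).
Hypothesis maxp : maximal_ideal p.

(** Such a list stands for distinct elements of the residue field, which is not formed as a type. *)
Fixpoint incongruent (s : seq A) : Prop :=
  if s is x :: s' then (forall y, y \in s' -> ~ p (y - x)) /\ incongruent s' else True.

(** This is the bound on the number of roots over the field [A/p], proved with representatives:
    dividing by [X - x] keeps the leading coefficient, and primality of [p] passes the other roots
    to the quotient. *)
Lemma incongruent_roots (P : {poly A}) (s : seq A) : ~ p (lead_coef P) ->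
  incongruent s -> (forall x, x \in s -> p P.[x]) -> (size s < size P)%N.
Proof.
have idp := maximal_ideal_ideal maxp.
elim: s P => [|x s IHs] P npP.
  move=> _ _; rewrite size_poly_gt0; apply/eqP => P0; apply: npP.
  by rewrite P0 lead_coef0; apply: ideal_zero.
move=> [xs incs] rootP; have px : p P.[x] by apply: rootP; rewrite mem_head.
have szP : (1 < size P)%N.
  rewrite ltnNge; apply/negP => /size1_polyC eP; apply: npP.
  by move: px; rewrite eP hornerC lead_coefC.
have szc : (size (- P.[x]%:P)%R < size P)%N.
  by rewrite size_polyN; apply: leq_ltn_trans (size_polyC_leq1 _) szP.
(* Subtracting the constant [P.[x]], which lies in [p], makes [x] a true root. *)
have /factor_theorem [q eq] : root (P - P.[x]%:P) x.
  by rewrite /root hornerD hornerN hornerC subrr.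
have lq : lead_coef q = lead_coef P.
  by rewrite -(lead_coef_Mmonic q (monicXsubC x)) -eq lead_coefDl.
have szq : size P = (size q).+1.
  rewrite -(size_polyDl szc) eq size_Mmonic ?monicXsubC ?size_XsubC ?addn2 //.
  rewrite -lead_coef_eq0 lq; apply/eqP => l0; apply: npP.
  by rewrite l0; apply: ideal_zero.
rewrite szq /= ltnS; apply: IHs => // [|y sy]; first by rewrite lq.
have py : p (q.[y] * (y - x)).
  have := congr1 (horner^~ y) eq; rewrite hornerM !hornerE => <-.
  by apply: ideal_sub => //; apply: rootP; rewrite inE sy orbT.
by have [|/(xs y sy)] := maximal_ideal_prime maxp py.
Qed.

Lemma exists_incongruent (N k : nat) : ~ residue_card_lt p N -> (k < N)%N ->
  exists s : seq A, [/\ size s = k, incongruent s & forall x, x \in s -> ~ p x].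
Proof.
move=> big; elim: k => [|k IHk] ltkN; first by exists [::].
have [s [szs incs nps]] := IHk (ltnW ltkN).
(* The list [0 :: s] is too short to cover all residues. Including 0 forces the new representative
   to lie outside [p]. *)
have [a npa] : exists a, forall b, b \in 0 :: s -> ~ p (a - b).
  apply: NNPP => nex; apply: big; exists (0 :: s); split; first by rewrite /= szs.
  move=> a; apply: NNPP => nb; apply: nex; exists a => b sb pab; apply: nb.
  by exists b.
exists (a :: s); split; first by rewrite /= szs.
  split=> // y sy; rewrite -opprB => /(ideal_opp (maximal_ideal_ideal maxp)).
  by rewrite opprK; apply: npa; rewrite inE sy orbT.
move=> x; rewrite inE => /orP[/eqP ->|]; last exact: nps.
by rewrite -[a]subr0; apply: npa; rewrite mem_head.
Qed.

(** There are [n + 1] distinct nonzero residues, while [X^n - 1] has at most [n] roots. *)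
Lemma exists_nonroot_residue n : (0 < n)%N -> ~ residue_card_lt p n.+2 ->
  exists2 u, ~ p u & ~ p (u ^+ n - 1).
Proof.
move=> n0 /exists_incongruent /(_ (leqnn _)) [s [szs incs nps]].
apply: NNPP => nex.
have : (size s < size ('X^n - 1 : {poly A})%R)%N.
  apply: incongruent_roots => // [|x sx].
    rewrite (_ : 'X^n - 1 = 'X^n - 1%:P) // lead_coefXnsubC //.
    exact: maximal_ideal_proper.
  rewrite !hornerE; apply: NNPP => npx; apply: nex; exists x => //; exact: nps.
by rewrite size_XnsubC // szs ltnn.
Qed.

End Residues.

(** * The kernel of [pr_n] and the equivalences *)

Section Main.
Variable A : idomainType.
Implicit Types (I p : A -> Prop) (a : A) (n : nat).

(** The [n + 1] elements [1 + z^(j+1)] are distinct and lie outside [p], so they cannot all be roots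
    of [X^n - 1]. This provides a nonzero element of [A] in [H_p]. *)
Lemma exists_expr_neq1 p n z : maximal_ideal p -> (0 < n)%N -> p z -> z != 0 ->
  exists2 u, ~ p u & u ^+ n - 1 != 0.
Proof.
move=> maxp n0 pz z0; have idp := maximal_ideal_ideal maxp.
have pzS j : p (z ^+ j.+1) by rewrite exprSr; apply: ideal_mull.
(* Powers of [z] never repeat, since [z^(d+1) = 1] would put 1 in [p]. *)
have neq i d : z ^+ (d.+1 + i) <> z ^+ i.
  move=> e; apply: (maximal_ideal_proper maxp).
  suff <- : z ^+ d.+1 = 1 by exact: pzS.
  by apply: (mulIf (expf_neq0 i z0)); rewrite -exprD e mul1r.
apply: NNPP => nex.
have : (size [seq (1 + z ^+ j.+1)%R | j <- iota 0 n.+1] < size ('X^n - 1%:P : {poly A})%R)%N.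
  apply: max_poly_roots.
    by rewrite -size_poly_eq0 size_XnsubC.
    apply/allP => _ /mapP [j _ ->]; apply/unity_rootP/eqP; rewrite -subr_eq0.
    apply/negPn/negP => ne; apply: nex; exists (1 + z ^+ j.+1) => //.
    move=> /(ideal_sub idp) /(_ (pzS j)); rewrite addrK.
    exact: maximal_ideal_proper.
  rewrite map_inj_uniq ?iota_uniq // => i j /addrI e.
  case: (ltngtP i j) => // lt; exfalso.
    by apply: (neq i.+1 (j - i).-1); rewrite e; congr (_ ^+ _); lia.
  by apply: (neq j.+1 (i - j).-1); rewrite -e; congr (_ ^+ _); lia.
by rewrite size_map size_iota size_XnsubC // ltnn.
Qed.

Lemma Hn_full p n a : maximal_ideal p -> (0 < n)%N -> ~ residue_card_lt p n.+2 ->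
  Hn p n (cconst a).
Proof.
move=> maxp n0 /(exists_nonroot_residue maxp n0) [u npu npun].
apply: (compl_gen_div maxp npun).
exact: (ideal_mulr (Hn_const_ideal p n) a (Hn_mem maxp n npu)).
Qed.

(** For [a] in [p], a nonzero [u^n - 1] in [H_p] yields a power of [p] inside [H_p] through
    [ideal_pow_local]. The bound covers every larger [M], so that finitely many primes can share one
    exponent. *)
Lemma Hn_eventually_congruing p n a : dedekind A -> maximal_ideal p -> (0 < n)%N ->
  exists N, forall M, (N <= M)%N -> Hn p n (cconst (a ^+ M * (a ^+ n - 1))).
Proof.
move=> dedA maxp n0; have idH := @Hn_const_ideal A p n.
case: (classic (p a)) => [pa|npa]; last first.
  by exists 0%N => M _; apply: (ideal_mull idH); apply: Hn_mem.
(* For [a = 0] no nonzero element of [p] is at hand; the exponent 1 already gives [0^M = 0]. *)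
have [->|a0] := eqVneq a 0.
  exists 1%N => M M0; rewrite expr0n eqn0Ngt M0 mul0r; exact: (ideal_zero idH).
have [u npu un0] := exists_expr_neq1 maxp n0 pa a0.
have [|k [s [nps sI]]] := ideal_pow_local dedA maxp (principal_ideal (u ^+ n - 1)).
  by exists (u ^+ n - 1); split=> //; exists 1; rewrite mul1r.
have [r e] := sI _ (ideal_powX k pa).
have Hak : Hn p n (cconst (a ^+ k)).
  apply: (compl_gen_div maxp nps); rewrite e.
  exact: (ideal_mull idH r (Hn_mem maxp n npu)).
exists k => M lekM; rewrite -(subnK lekM) exprD.
by apply: (ideal_mulr idH); apply: (ideal_mull idH).
Qed.

Lemma ker_pr_ideal n : ideal (@ker_pr A n).
Proof.
pose idH p := @Hn_const_ideal A p n.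
split; [|split].
- by move=> p _; apply: (ideal_zero (idH p)).
- by move=> x y kx ky p maxp; apply: (ideal_add (idH p)); [apply: kx|apply: ky].
- by move=> r x kx p maxp; apply: (ideal_mull (idH p)); apply: kx.
Qed.

Lemma ker_pr_congruing n : dedekind A -> minkowski A -> (0 < n)%N ->
  congruing n (@ker_pr A n).
Proof.
move=> dedA [_ /(_ n.+2) [m [P Pfin]]] n0 a.
have [N HN] : exists N, forall i, (i < m)%N -> maximal_ideal (P i) ->
    forall M, (N <= M)%N -> Hn (P i) n (cconst (a ^+ M * (a ^+ n - 1))).
  (* The common exponent is a maximum; entries [P i] that are not maximal ideals impose no
     condition. *)
  elim: m {Pfin} => [|m [N HN]]; first by exists 0%N.
  case: (classic (maximal_ideal (P m))) => [maxm|nmaxm]; last first.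
    exists N => i; rewrite ltnS leq_eqVlt => /orP[/eqP -> /nmaxm //|]; exact: HN.
  have [N' HN'] := Hn_eventually_congruing a dedA maxm n0.
  exists (maxn N N') => i; rewrite ltnS leq_eqVlt => lei maxi M.
  rewrite geq_max => /andP[leN leN']; case/orP: lei => [/eqP ->|lti]; first exact: HN'.
  exact: HN.
exists N => p maxp; case: (classic (residue_card_lt p n.+2)) => [small|big].
  have [i [lti ePi]] := Pfin p maxp small.
  have eP : p = P i by apply: functional_extensionality => x; apply: propositional_extensionality.
  by rewrite eP; apply: HN => //; rewrite -eP.
exact: Hn_full.
Qed.

(** For [I] nonzero this is [ideal_pow_local]. If [I = 0], each [a] in [p] satisfies [a = 0] or
    [a^n = 1], and the latter would put 1 in [p]; hence [p = 0] and [k = 1] works. *)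
Lemma congruing_local p n I : dedekind A -> maximal_ideal p -> ideal I -> (0 < n)%N ->
  congruing n I -> exists k s, ~ p s /\ forall x, ideal_pow p k x -> I (s * x).
Proof.
move=> dedA maxp idI n0 congI.
case: (classic (exists x, I x /\ x != 0)) => [|I0]; first exact: ideal_pow_local.
have {}I0 x : I x -> x = 0.
  by move=> Ix; apply/eqP/negPn/negP => x0; apply: I0; exists x.
have p0 a : p a -> a = 0.
  have [N /I0 /eqP] := congI a; rewrite mulf_eq0 => /orP[|/eqP an1 pa].
    by rewrite expf_eq0 => /andP[_ /eqP].
  case: (maximal_ideal_proper maxp).
  rewrite -[1](subrK (a ^+ n)) -opprB an1 oppr0 add0r -(prednK n0) exprS.
  exact: (ideal_mulr (maximal_ideal_ideal maxp)).
exists 1%N, 1; split; first exact: maximal_ideal_proper.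
refine (ideal_powS_ind _ _ _) => [|x y|u v _ /p0 ->].
- by rewrite mulr0; exact: ideal_zero.
- by rewrite mulrDr; exact: ideal_add.
- by rewrite !mulr0; exact: ideal_zero.
Qed.

(** Locally at [p], [a] is in the extension of [I], hence close to some [b] in [I]. If [s p^k] lies
    in [I], then [s a = s (a - b) + s b] does too. *)
Lemma ker_pr_sub n I : dedekind A -> ideal I ->
  (forall p, maximal_ideal p -> compl_congruing p n (compl_ext p I)) ->
  forall a, ker_pr n a -> I a.
Proof.
move=> dedA idI congI a ka; have [noeth _] := dedA.
apply: (ideal_local noeth idI) => p maxp.
have aI := Hn_sub_ext (congI p maxp) (ka p maxp).
case: (classic (exists x, I x /\ x != 0)) => [nzI|I0].
  have [k [s [nps sI]]] := ideal_pow_local dedA maxp idI nzI.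
  have [b Ib pab] := compl_ext_approx k idI aI.
  exists s => //; rewrite -[a](subrK b) mulrDr; apply: ideal_add => //.
    exact: sI.
  exact: ideal_mull.
(* For [I = 0] every approximation [b] is 0, so [a] lies in all powers of [p] and vanishes by
   Krull's theorem. *)
exists 1; first exact: maximal_ideal_proper.
rewrite (ideal_pow_cap0 dedA maxp (a := a)); first by rewrite mulr0; apply: ideal_zero.
move=> k; have [b Ib] := compl_ext_approx k idI aI.
have -> : b = 0 by apply/eqP/negPn/negP => b0; apply: I0; exists b.
by rewrite subr0.
Qed.

End Main.

Theorem mainTheorem10 (A : idomainType) (n : nat) :
  dedekind A -> minkowski A -> (0 < n)%N ->
  (forall I : A -> Prop, ideal I ->
     (congruing n I <->
        (forall p, maximal_ideal p -> compl_congruing p n (compl_ext p I))) /\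
     (congruing n I <-> (forall a, ker_pr n a -> I a))) /\
  (ideal (@ker_pr A n) /\ congruing n (@ker_pr A n) /\
   (forall I : A -> Prop, ideal I -> congruing n I -> forall a, ker_pr n a -> I a) /\
   (forall J : A -> Prop, ideal J -> congruing n J ->
      (forall J' : A -> Prop, ideal J' -> congruing n J' ->
         (forall a, J' a -> J a) -> forall a, J a -> J' a) ->
      forall a, J a <-> ker_pr n a)).
Proof.
move=> dedA minkA n0; have [noeth _] := dedA.
have idK := @ker_pr_ideal A n; have congK := ker_pr_congruing dedA minkA n0.
(* Each [cij] is the implication from condition (i) to condition (j). *)
have c12 (I : A -> Prop) : ideal I -> congruing n I ->
    forall p, maximal_ideal p -> compl_congruing p n (compl_ext p I).
  move=> idI congI p maxp.
  have [k [s [nps sI]]] := congruing_local dedA maxp idI n0 congI.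
  exact: (compl_ext_congruing maxp noeth idI nps sI congI).
have c23 I := @ker_pr_sub A n I dedA.
have c31 (I : A -> Prop) : (forall a, ker_pr n a -> I a) -> congruing n I.
  by move=> KI a; have [N KN] := congK a; exists N; apply: KI.
have c13 (I : A -> Prop) : ideal I -> congruing n I -> forall a, ker_pr n a -> I a.
  by move=> idI congI; apply: c23 => //; apply: c12.
split; last first.
  (* Uniqueness: [ker_pr n] is an [n]-congruing ideal inside [J], so minimality of [J] gives the
     reverse inclusion. *)
  do 3!split=> //; move=> J idJ congJ minJ a; split; last exact: c13.
  by apply: minJ => // b; apply: c13.
move=> I idI; split; split.
- exact: c12.
- by move=> cI; apply: c31; apply: c23.
- exact: c13.
- exact: c31.
Qed.
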